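(* Let $\lambda_1,\ldots,\lambda_n\in(0,1)$, let $p_1,\ldots,p_n\in\mathbb{R}^d$, let $f_j(x)=\lambda_j x+(1-\lambda_j)p_j$ for $1\le j\le n$, and let $\Lambda\subset\mathbb{R}^d$ be the attractor of $\{f_j\}_{j=1}^n$. Suppose $\sum_{j=1}^{n}\lambda_j^d=1$ and $\mathcal{L}(\Lambda)>0$. Then Lebesgue almost every $x\in\Lambda$ has a unique coding.
   Context: The attractor $\Lambda$ of $\{f_j\}_{j=1}^n$ is the unique nonempty compact set $\Lambda\subset\mathbb{R}^d$ with $\Lambda=\bigcup_{j=1}^n f_j(\Lambda)$. A coding of $x\in\Lambda$ is a sequence $(\epsilon_i)_{i=1}^\infty\in\{1,\ldots,n\}^{\mathbb{N}}$ such that $\lim_{N\to\infty}f_{\epsilon_1}\cdots f_{\epsilon_N}(0)=x$, where $f_{\epsilon_1}\cdots f_{\epsilon_N}$ denotes the composition $f_{\epsilon_1}\circ\cdots\circ f_{\epsilon_N}$. $\mathcal{L}$ denotes $d$-dimensional Lebesgue measure. *)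

(* Defs.v *)
From HB Require Import structures.
From mathcomp Require Import all_boot all_order all_algebra.
From mathcomp Require Import all_classical all_reals all_analysis.

Set Implicit Arguments.
Unset Strict Implicit.
Unset Printing Implicit Defensive.

Import Order.TTheory GRing.Theory Num.Theory.
Import numFieldNormedType.Exports.

Local Open Scope classical_set_scope.
Local Open Scope ring_scope.

(* The library has Lebesgue measure on R only. On R^d = 'rV[R]_d it is built
   here in the textbook way: the outer measure of A is the infimum of the total
   volume of countable families of closed boxes covering A, and Lebesgue measure
   is its restriction to the Caratheodory measurable sets. *)
Section lebesgue_measure_rV.
Context {R : realType} {d : nat}.
Implicit Types (c : 'rV[R]_d * 'rV[R]_d) (C : set ('rV[R]_d * 'rV[R]_d)).

Definition box c : set 'rV[R]_d :=
  [set x | forall i, c.1 0 i <= x 0 i <= c.2 0 i].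

Definition box_volume c : R := \prod_i Num.max 0 (c.2 0 i - c.1 0 i).

Definition box_cover (A : set 'rV[R]_d) C :=
  countable C /\ A `<=` \bigcup_(c in C) box c.

Definition lebesgue_outer (A : set 'rV[R]_d) : \bar R :=
  ereal_inf [set \esum_(c in C) (box_volume c)%:E | C in box_cover A]%E.

Local Open Scope ereal_scope.

Lemma box_volume_ge0 c : 0 <= (box_volume c)%:E.
Proof. by rewrite lee_fin prodr_ge0// => i _; rewrite le_max lexx. Qed.

Lemma lebesgue_outer_ge0 A : 0 <= lebesgue_outer A.
Proof.
apply: le_ereal_inf_tmp => _ [C _ <-].
by apply: esum_ge0 => c _; exact: box_volume_ge0.
Qed.

Lemma lebesgue_outer0 : lebesgue_outer set0 = 0.
Proof.
apply/eqP; rewrite eq_le lebesgue_outer_ge0 andbT.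
apply: ereal_inf_lbound; exists set0; last by rewrite esum_set0.
by split => //; exact: countable0.
Qed.

Lemma le_lebesgue_outer : {homo lebesgue_outer : A B / A `<=` B >-> A <= B}.
Proof.
move=> A B AB; apply/ereal_inf_le_tmp => _ [C [cC BC] <-].
by exists C => //; split => //; exact: subset_trans BC.
Qed.

Lemma lebesgue_outer_sigma_subadditive : sigma_subadditive lebesgue_outer.
Proof.
move=> A; have [[i ioo]|] := pselect (exists i, lebesgue_outer (A i) = +oo).
  rewrite (eseries_pinfty _ _ ioo) ?leey// => n _.
  by rewrite -ltNye (lt_le_trans _ (lebesgue_outer_ge0 _)).
rewrite -forallNE => Aoo.
apply/lee_addgt0Pr => e e0.
rewrite (le_trans _ (epsilon_trick _ _ (ltW e0)))//; last first.
  by move=> n; exact: lebesgue_outer_ge0.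
have [C PC] : {C : nat -> set ('rV[R]_d * 'rV[R]_d) & forall n,
    box_cover (A n) (C n) /\ \esum_(c in C n) (box_volume c)%:E <=
      lebesgue_outer (A n) + (e / (2 ^ n.+1)%:R)%:E}.
  apply: (@choice _ _ (fun n C => box_cover (A n) C /\
    \esum_(c in C) (box_volume c)%:E <= _)) => n.
  have en0 : (0 < e / (2 ^ n.+1)%:R)%R by rewrite divr_gt0// ltr0n expn_gt0.
  have Afin : lebesgue_outer (A n) \is a fin_num.
    by rewrite ge0_fin_numE ?lebesgue_outer_ge0// ltey; apply/eqP; exact: Aoo.
  have [_ [C AC <-] /ltW ?] := lb_ereal_inf_adherent en0 Afin.
  by exists C.
apply: (@le_trans _ _ (\esum_(c in \bigcup_n C n) (box_volume c)%:E)).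
  apply: ereal_inf_lbound; exists (\bigcup_n C n) => //; split.
    by apply: bigcup_countable => // n _; exact: (PC n).1.1.
  move=> x [n _ /(PC n).1.2[c Cc cx]].
  by exists c => //; exists n.
rewrite seqDU_bigcup_eq esum_bigcupT; last 2 first.
- exact: trivIset_seqDU.
- by move=> c; exact: box_volume_ge0.
rewrite nneseries_esumT; last first.
  by move=> n; rewrite adde_ge0 ?lebesgue_outer_ge0// lee_fin divr_ge0// ltW.
apply: le_esum => n _; apply: le_trans (PC n).2.
apply: ereal_sup_le => _ [F [finF FC] <-].
by exists F => //; split => //; apply: subset_trans FC _; exact: subDsetl.
Qed.

HB.instance Definition _ := isOuterMeasure.Build R 'rV[R]_d lebesgue_outer
  lebesgue_outer0 lebesgue_outer_ge0 le_lebesgue_outer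
  lebesgue_outer_sigma_subadditive.

End lebesgue_measure_rV.

Definition lebesgue_measure_rV {R : realType} {d : nat} :
  set (caratheodory_type (@lebesgue_outer R d)) -> \bar R := lebesgue_outer.
HB.instance Definition _ (R : realType) (d : nat) :=
  isMeasure.Build _ _ _ (@lebesgue_measure_rV R d)
    (@caratheodory_measure0 R _ lebesgue_outer)
    (@caratheodory_measure_ge0 R _ lebesgue_outer)
    (@caratheodory_measure_sigma_additive R _ lebesgue_outer).

Section ifs.
Context {R : realType} {d n : nat}.
Implicit Types (f : 'I_n -> 'rV[R]_d -> 'rV[R]_d) (e : nat -> 'I_n).

Definition is_attractor f (L : set 'rV[R]_d) :=
  [/\ L !=set0, compact L & L = \bigcup_j (f j @` L)].

(* f_(e 0) \o ... \o f_(e (N - 1)); symbols and positions count from 0. *)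
Fixpoint word_comp f e (N : nat) : 'rV[R]_d -> 'rV[R]_d :=
  if N is N'.+1 then word_comp f e N' \o f (e N') else id.

Definition is_coding f (x : 'rV[R]_d) e :=
  word_comp f e N 0 @[N --> \oo] --> x.

Definition similarity (lam : 'I_n -> R) (p : 'I_n -> 'rV[R]_d) (j : 'I_n)
    (x : 'rV[R]_d) : 'rV[R]_d :=
  lam j *: x + (1 - lam j) *: p j.

End ifs.

(* Main.v *)
(** A similarity of ratio [r] multiplies outer measure by at most [r ^+ d], so
    [L], the union of the [f j @` L], has measure at most
    [\sum_j lam j ^+ d * |L| = |L|]. Equality holds throughout; since compact sets
    are Caratheodory measurable, the pairwise overlaps [f i @` L `&` f j @` L]
    are null. A point with two codings lies, at the first position where they
    differ, in the image of such an overlap under a finite composition of the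
    maps, and there are only countably many of these null images. *)

Require Import Defs.
From mathcomp Require Import all_boot all_order all_algebra.
From mathcomp Require Import all_classical all_reals all_analysis.
From mathcomp Require Import ring lra.

Set Implicit Arguments.
Unset Strict Implicit.
Unset Printing Implicit Defensive.

Import Order.TTheory GRing.Theory Num.Theory.
Import numFieldNormedType.Exports.
Local Open Scope classical_set_scope.
Local Open Scope ring_scope.

(** * Sums of extended reals over sets *)

Section esum_extra.
Local Open Scope ereal_scope.
Context {R : realType} {T : choiceType}.

Lemma subset_esum (C D : set T) (a : T -> \bar R) :
  C `<=` D -> \esum_(c in C) a c <= \esum_(c in D) a c.
Proof.
move=> CD; apply: ereal_sup_le => _ [F [finF FC] <-].
by exists F => //; split => //; exact: subset_trans CD.
Qed.

(** Choosing one preimage per point of the image turns the left side into a subsum of the right.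
    Covers are sets of boxes, so a transformation [h] may merge boxes; this bounds the volume of the
    transformed cover all the same. *)
Lemma le_esum_image (T' : choiceType) (C : set T) (h : T -> T')
    (a : T' -> \bar R) :
  \esum_(y in h @` C) a y <= \esum_(c in C) a (h c).
Proof.
have [->|/set0P[c0 _]] := eqVneq C set0.
  by rewrite image_set0 !esum_set0.
pose g y := xget c0 [set c | C c /\ h c = y].
have gP y : (h @` C) y -> C (g y) /\ h (g y) = y.
  by case=> c Cc hc; apply: (@xgetPex _ c0 [set c | C c /\ h c = y]); exists c.
rewrite (eq_esum (b := fun y => a (h (g y)))); last by move=> y /gP[_ ->].
rewrite -(esum_image _ g (a \o h)); last first.
  move=> y y' /set_mem/gP[_ hy] /set_mem/gP[_ hy'] gyy'.
  by rewrite -hy gyy' hy'.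
by apply: subset_esum => _ [y /gP[Cgy _] <-].
Qed.

Lemma le_esumZl (C : set T) (k : R) (a : T -> \bar R) :
  (0 <= k)%R -> (forall c, 0 <= a c) ->
  \esum_(c in C) (k%:E * a c) <= k%:E * \esum_(c in C) a c.
Proof.
move=> k0 a0; apply: ge_ereal_sup => _ [F [finF FC] <-].
rewrite -ge0_mule_fsumr//.
by apply: lee_wpmul2l; [rewrite lee_fin | apply: esum_ge; exists F].
Qed.

End esum_extra.

(** * Lebesgue outer measure: scaling, measurable sets, finiteness *)

Section lebesgue_outer_extra.
Context {R : realType} {d : nat}.
Implicit Types (c : 'rV[R]_d * 'rV[R]_d) (A : set 'rV[R]_d).

Lemma lebesgue_outer_affine (a : R) (b : 'rV[R]_d) A : 0 < a ->
  (lebesgue_outer ((fun x => a *: x + b)%R @` A) <=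
    (a ^+ d)%:E * lebesgue_outer A)%E.
Proof.
move=> a0; have ad0 : 0 < a ^+ d by rewrite exprn_gt0.
(* Dividing by [a ^+ d] leaves the infimum alone on the right, so a single cover [C] can be fixed
   and then pushed forward. *)
rewrite -lee_pdivrMl//; apply: le_ereal_inf_tmp => _ [C [cC AC] <-].
rewrite lee_pdivrMl//.
pose h c := (a *: c.1 + b, a *: c.2 + b).
have hvol c : box_volume (h c) = a ^+ d * box_volume c.
  rewrite /box_volume -[X in a ^+ X]card_ord -prodr_const -big_split/=.
  apply: eq_bigr => i _; rewrite !mxE maxr_pMr ?ltW// mulr0.
  by congr Num.max; ring.
apply: le_trans (le_esumZl C (ltW ad0) (@box_volume_ge0 R d)).
under eq_esum do rewrite -EFinM -hvol.
apply: le_trans (le_esum_image C h (fun c => (box_volume c)%:E)).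
apply: ereal_inf_lbound; exists (h @` C) => //; split.
  exact: sub_countable (card_image_le _ _) cC.
move=> _ [x /AC[c Cc cx] <-]; exists (h c); first by exists c.
by move=> i; rewrite !mxE !lerD2r !ler_pM2l//; exact: cx.
Qed.

(** The hyperplane where coordinate [i] equals [a] cuts [c] into [c1] and [c2]. If it misses [c],
    one of the two has a nonpositive side, which [box_volume] counts as 0. *)
Lemma box_volume_split c c1 c2 (i : 'I_d) (a : R) :
  (forall j, c1.1 0 j = c.1 0 j) ->
  (forall j, c1.2 0 j = if j == i then Num.min (c.2 0 j) a else c.2 0 j) ->
  (forall j, c2.1 0 j = if j == i then Num.max (c.1 0 j) a else c.1 0 j) ->
  (forall j, c2.2 0 j = c.2 0 j) ->
  box_volume c1 + box_volume c2 = box_volume c.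
Proof.
move=> c11 c12 c21 c22; rewrite /box_volume.
rewrite (bigD1 i)//= [X in _ + X](bigD1 i)//= [RHS](bigD1 i)//= c11 c12 c21 c22 eqxx.
rewrite (eq_bigr (fun j => Num.max 0 (c.2 0 j - c.1 0 j))); last first.
  by move=> j /negbTE ji; rewrite c11 c12 ji.
rewrite [X in _ + _ * X = _](eq_bigr (fun j => Num.max 0 (c.2 0 j - c.1 0 j)));
  last by move=> j /negbTE ji; rewrite c21 c22 ji.
rewrite -mulrDl; congr (_ * _).
rewrite !maxEle minEle.
by repeat case: ifPn; rewrite -?ltNge; lra.
Qed.

(* The boundary hyperplane may be divided arbitrarily between [H] and its
   complement, which covers open and closed half-spaces at once. *)
Lemma half_space_caratheodory (i : 'I_d) (a : R) (H : set 'rV[R]_d) :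
  (forall x : 'rV[R]_d, x 0 i < a -> H x) -> (forall x, H x -> x 0 i <= a) ->
  lebesgue_outer.-caratheodory H.
Proof.
move=> ltH Hle; apply: le_caratheodory_measurable => X /=.
apply: le_ereal_inf_tmp => _ [C [cC XC] <-].
(* Every box of a cover of [X] is cut in two: the lower parts cover the points of [X] in [H], the
   upper parts cover the others, and the total volume is unchanged. *)
pose h1 c := (c.1, \row_j if j == i then Num.min (c.2 0 j) a else c.2 0 j).
pose h2 c := (\row_j if j == i then Num.max (c.1 0 j) a else c.1 0 j, c.2).
rewrite [leRHS](eq_esum
  (b := fun c => ((box_volume (h1 c))%:E + (box_volume (h2 c))%:E)%E)); last first.
  move=> c _; rewrite -EFinD -(@box_volume_split c (h1 c) (h2 c) i a)//=;
  by move=> j; rewrite mxE.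
rewrite esumD; last 2 first.
- by move=> c _; exact: box_volume_ge0.
- by move=> c _; exact: box_volume_ge0.
apply: leeD.
- apply: le_trans (le_esum_image C h1 (fun c => (box_volume c)%:E)).
  apply: ereal_inf_lbound; exists (h1 @` C) => //; split.
    exact: sub_countable (card_image_le _ _) cC.
  move=> x [/XC[c Cc cx] /Hle xa]; exists (h1 c); first by exists c.
  move=> j; rewrite /= mxE; have /andP[-> /=] := cx j.
  by case: eqP => [->|//]; rewrite le_min xa andbT.
- apply: le_trans (le_esum_image C h2 (fun c => (box_volume c)%:E)).
  apply: ereal_inf_lbound; exists (h2 @` C) => //; split.
    exact: sub_countable (card_image_le _ _) cC.
  move=> x [/XC[c Cc cx] Hx]; exists (h2 c); first by exists c.
  have ax : a <= x 0 i by rewrite leNgt; apply/negP => /ltH.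
  move=> j; rewrite /= mxE; have /andP[+ ->] := cx j; rewrite andbT.
  by case: eqP => [->|//]; rewrite ge_max ax andbT.
Qed.

Let cara := caratheodory_type (@lebesgue_outer R d).

(** A box is an intersection of half-spaces; complements turn the intersection over coordinates into
    a countable union. *)
Lemma box_caratheodory c : measurable (box c : set cara).
Proof.
rewrite -[X in measurable X]setCK; apply: measurableC.
rewrite (_ : ~` _ = \bigcup_i (~` ([set x : cara | c.1 0 i <= x 0 i] `&`
    [set x : cara | x 0 i <= c.2 0 i]))); last first.
  rewrite -setC_bigcap; congr (~` _); apply/seteqP; split => x /=.
    by move=> cx i _; apply/andP; exact: cx.
  by move=> cx i; apply/andP; exact: cx.
apply: countable_bigcupT_measurable; first exact: countableP.
move=> i; apply: measurableC; apply: measurableI.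
- rewrite -[X in measurable X]setCK; apply: measurableC.
  apply: (@half_space_caratheodory i (c.1 0 i)) => x /=.
    by rewrite ltNge => /negP.
  by move/negP; rewrite -ltNge => /ltW.
- by apply: (@half_space_caratheodory i (c.2 0 i)) => x //=; exact: ltW.
Qed.

Lemma open_caratheodory (U : set 'rV[R]_d) :
  open U -> measurable (U : set cara).
Proof.
move=> openU.
(* [b (k, z)] is the grid cube of side [1 / (k + 1)] with lower corner [z / (k + 1)]. There are
   countably many, and those inside [U] exhaust it. *)
pose b (t : nat * 'rV[int]_d) : 'rV[R]_d * 'rV[R]_d :=
  (\row_i ((t.2 0 i)%:~R / t.1.+1%:R), \row_i ((t.2 0 i + 1)%:~R / t.1.+1%:R)).
have -> : U = \bigcup_t (if `[< box (b t) `<=` U >] then box (b t) else set0).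
  apply/seteqP; split => [x Ux|x [t _]]; last by case: asboolP => // + xt; apply.
  have /nbhs_ballP[e /= e0 xeU] := open_nbhs_nbhs (conj openU Ux).
  have [k ke] : exists k, k.+1%:R^-1 < e.
    have /filter_ex[k ke] := near_infty_natSinv_lt (PosNum e0).
    by exists k.
  (* Balls are described coordinatewise, so a cube of side [q < e] containing [x] lies in the ball
     of radius [e] about [x]. *)
  have aux (w q u v : R) :
      q < e -> w <= u < w + q -> w <= v <= w + q -> `|u - v| < e.
    by move=> ? /andP[? ?] /andP[? ?]; rewrite ltr_norml; apply/andP; split; lra.
  pose z := \row_i Num.floor (x 0 i * k.+1%:R).
  have xz i : (z 0 i)%:~R / k.+1%:R <= x 0 i < (z 0 i + 1)%:~R / k.+1%:R.
    rewrite mxE ler_pdivrMr// ltr_pdivlMr//.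
    by rewrite floor_le floorD1_gt.
  have xb : box (b (k, z)) x.
    move=> i; have /andP[xl /ltW xu] := xz i.
    by rewrite /= !mxE in xl xu *; rewrite xl xu.
  exists (k, z) => //; case: asboolP => // bU; exfalso; apply: bU => y yb.
  apply: xeU; split=> // i' i; rewrite (ord1 i').
  have := yb i; have := xz i; rewrite /= !mxE intrD mulrDl mul1r.
  exact: aux ke.
apply: countable_bigcupT_measurable; first exact: countableP.
by move=> t; case: asboolP => _ //; exact: box_caratheodory.
Qed.

Lemma compact_caratheodory (K : set 'rV[R]_d) :
  compact K -> measurable (K : set cara).
Proof.
move=> cK; rewrite -[X in measurable X]setCK; apply: measurableC.
by apply: open_caratheodory; apply: closed_openC; exact: compact_closed.
Qed.

Lemma norm_coord (x : 'rV[R]_d) i : `|x 0 i| <= `|x|.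
Proof. by rewrite [leRHS]mx_normrE; apply: (le_bigmax _ _ (0, i)). Qed.

Lemma compact_lebesgue_outer (K : set 'rV[R]_d) :
  compact K -> lebesgue_outer K \is a fin_num.
Proof.
move=> /compact_bounded[M [_ KM]].
rewrite ge0_fin_numE ?lebesgue_outer_ge0//.
(* The norm on [K] is bounded by every number above [M], hence [M + 1]. *)
pose c : 'rV[R]_d * 'rV[R]_d := (const_mx (- (M + 1)), const_mx (M + 1)).
apply: (@le_lt_trans _ _ (box_volume c)%:E); last exact: ltry.
apply: ereal_inf_lbound; exists [set c]; last first.
  by rewrite esum_set1// box_volume_ge0.
split; first exact: countable1.
move=> x Kx; exists c => // i; rewrite !mxE -ler_norml.
by apply: le_trans (norm_coord x i) _; apply: (KM (M + 1)) => //; rewrite ltrDl.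
Qed.

(** An outer null set satisfies the Caratheodory condition, since its part of any [X] contributes 0;
    it is thus its own measurable null cover. *)
Lemma lebesgue_outer_negligible A :
  lebesgue_outer A = 0%E -> (@lebesgue_measure_rV R d).-negligible A.
Proof.
move=> A0; exists A; split => //.
apply: le_caratheodory_measurable => X /=.
rewrite [X in (X + _)%E](_ : _ = 0%E) ?add0e.
  by apply: le_lebesgue_outer; exact: subIsetl.
apply/eqP; rewrite eq_le lebesgue_outer_ge0 andbT -A0.
by apply: le_lebesgue_outer; exact: subIsetr.
Qed.

End lebesgue_outer_extra.

Lemma outer_measure_bigsetU_le {R : realType} {T : Type} {I : finType}
    (mu : {outer_measure set T -> \bar R}) (P : pred I) (A : I -> set T) :
  (mu (\big[setU/set0]_(i | P i) A i) <= \sum_(i | P i) mu (A i))%E.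
Proof.
elim/big_ind2: _ => [|B b D c Bb Dc|//]; first by rewrite outer_measure0.
exact: le_trans (outer_measureU2 _ _ _) (leeD Bb Dc).
Qed.

(** * The attractor: overlaps of its pieces, finite words *)

Section attractor.
Context {R : realType} {d n : nat}.
Variables (lam : 'I_n -> R) (p : 'I_n -> 'rV[R]_d) (L : set 'rV[R]_d).
Hypothesis lam01 : forall j, 0 < lam j < 1.
Hypothesis attrL : is_attractor (similarity lam p) L.
Let f := similarity lam p.

Let lam_gt0 j : 0 < lam j. Proof. by have /andP[] := lam01 j. Qed.

Lemma similarity_inj j : injective (f j).
Proof.
move=> x y /addIr /(congr1 (fun v => (lam j)^-1 *: v)).
by rewrite !scalerA mulVf ?scale1r// gt_eqF.
Qed.

Lemma similarity_continuous j : continuous (f j).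
Proof.
move=> x; apply: (@continuousD _ _ _ ( *:%R (lam j)) (cst ((1 - lam j) *: p j))).
  exact: scaler_continuous.
exact: cst_continuous.
Qed.

Lemma attractor_compact_image j : compact (f j @` L).
Proof.
have [_ cL _] := attrL; apply: continuous_compact => //.
by apply: continuous_subspaceT; exact: similarity_continuous.
Qed.

Lemma lebesgue_outer_similarity j (A : set 'rV[R]_d) :
  (lebesgue_outer (f j @` A) <= (lam j ^+ d)%:E * lebesgue_outer A)%E.
Proof. exact: lebesgue_outer_affine. Qed.

Lemma attractor_overlap_null i j : \sum_(k < n) lam k ^+ d = 1 -> i != j ->
  lebesgue_outer (f i @` L `&` f j @` L) = 0%E.
Proof.
move=> sum_lam ij; have [_ cL LE] := attrL.
(* All measures involved are finite, so the comparison can be done in [R], where subtraction is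
   harmless. *)
pose m (A : set 'rV[R]_d) := fine (lebesgue_outer A).
have finL (A B : set 'rV[R]_d) : A `<=` B ->
    lebesgue_outer B \is a fin_num -> lebesgue_outer A \is a fin_num.
  rewrite !ge0_fin_numE ?lebesgue_outer_ge0// => /le_lebesgue_outer.
  exact: le_lt_trans.
have fk k := compact_lebesgue_outer (@attractor_compact_image k).
have fL := compact_lebesgue_outer cL.
have mi : lebesgue_outer.-caratheodory (f i @` L).
  exact: (compact_caratheodory (@attractor_compact_image i)).
have mk k : m (f k @` L) <= lam k ^+ d * m L.
  rewrite -lee_fin EFinM !fineK//; exact: lebesgue_outer_similarity.
have sub k (D : set 'rV[R]_d) : lebesgue_outer (f k @` L `&` D) \is a fin_num.
  by apply: finL (fk k); exact: subIsetl.
have split_k k :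
    m (f k @` L) = m (f k @` L `&` f i @` L) + m (f k @` L `&` ~` (f i @` L)).
  by rewrite /m (mi (f k @` L)) fineD.
(* [L] is split along its measurable piece of index [i]; what lies outside is covered by the other
   pieces with that piece removed. *)
have le_L : m L <= m (f i @` L) +
    \sum_(k | k != i) m (f k @` L `&` ~` (f i @` L)).
  rewrite -lee_fin EFinD -sumEFin /m !fineK// (eq_bigr (fun k =>
    lebesgue_outer (f k @` L `&` ~` (f i @` L)))); last by move=> k _; rewrite fineK.
  rewrite (mi L); apply: leeD; first by apply: le_lebesgue_outer; exact: subIsetr.
  apply: le_trans (outer_measure_bigsetU_le _ _ _); apply: le_lebesgue_outer.
  move=> x [+ xi]; rewrite {1}LE => -[k _ xk].
  rewrite (bigD1 k)/=; first by left.
  by apply/eqP => ki; apply: xi; rewrite -ki.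
have m_ge0 A : 0 <= m A by rewrite fine_ge0// lebesgue_outer_ge0.
suff : m (f j @` L `&` f i @` L) <= 0.
  move=> mji; apply/eqP; rewrite eq_le lebesgue_outer_ge0 andbT setIC.
  by rewrite -(fineK (sub j _)) lee_fin.
have mL : m L = lam i ^+ d * m L + \sum_(k | k != i) lam k ^+ d * m L.
  by rewrite -mulr_suml -mulrDl -[LHS]mul1r -sum_lam (bigD1 i).
have ji : j != i by rewrite eq_sym.
rewrite (bigD1 j ji)/= in le_L; rewrite (bigD1 j ji)/= in mL; move: le_L mL.
have : \sum_(k | (k != i) && (k != j)) m (f k @` L `&` ~` (f i @` L)) <=
    \sum_(k | (k != i) && (k != j)) lam k ^+ d * m L.
  apply: ler_sum => k _; apply: le_trans (mk k).
  by rewrite (split_k k) lerDr.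
have := mk i; have := mk j; have := split_k j.
(* With [s <= t] for the remaining indices, any positive overlap of pieces [i] and [j] would make
   the bound in [le_L] smaller than [m L]. *)
move: (\sum_(k | _) _) (\sum_(k | _) _) => s t; lra.
Qed.

(** Words are lists here, hence form a countable type, whereas [word_comp] reads prefixes of an
    infinite sequence. *)
Definition word_map (s : seq 'I_n) : 'rV[R]_d -> 'rV[R]_d :=
  foldr (fun j g => f j \o g) id s.

Lemma word_comp_map e N : word_comp f e N = word_map (mkseq e N).
Proof.
have rcE s j : word_map (rcons s j) = word_map s \o f j.
  by elim: s => //= k s ->.
by elim: N => // N IHN; rewrite mkseqS rcE -IHN.
Qed.

Lemma word_map_inj s : injective (word_map s).
Proof. by elim: s => //= j s IHs; apply: inj_comp => //; exact: similarity_inj. Qed.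

Lemma word_map_null s (A : set 'rV[R]_d) :
  lebesgue_outer A = 0%E -> lebesgue_outer (word_map s @` A) = 0%E.
Proof.
move=> A0; elim: s => [|j s IHs]; first by rewrite image_id.
apply/eqP; rewrite eq_le lebesgue_outer_ge0 andbT /= -image_comp.
apply: le_trans (lebesgue_outer_similarity j _) _.
by rewrite IHs mule0.
Qed.

(** * Contraction and codings *)

Lemma word_comp_contract : exists2 r, 0 <= r < 1 &
  forall e N x y, `|word_comp f e N x - word_comp f e N y| <= r ^+ N * `|x - y|.
Proof.
pose r := \big[Num.max/0]_j lam j.
have r0 : 0 <= r by exact: bigmax_ge_id.
exists r.
  by rewrite r0/=; apply/bigmax_ltP; split => // j _; have /andP[] := lam01 j.
move=> e; elim => [|N IHN] x y; first by rewrite mul1r.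
apply: le_trans (IHN _ _) _; rewrite exprSr -mulrA ler_wpM2l ?exprn_ge0//.
rewrite /f /similarity opprD addrACA subrr addr0 -scalerBr normrZ.
by rewrite ler_wpM2r// gtr0_norm// le_bigmax.
Qed.

(** The two sequences differ by at most [r ^+ N * (M + M)], which tends to 0. This trades the base
    point 0 in [is_coding] for points of [L]. *)
Lemma word_comp_cvg_swap e (x : 'rV[R]_d) (y z : nat -> 'rV[R]_d) (M : R) :
  (forall N, `|y N| <= M) -> (forall N, `|z N| <= M) ->
  word_comp f e N (z N) @[N --> \oo] --> x ->
  word_comp f e N (y N) @[N --> \oo] --> x.
Proof.
move=> yM zM zx; have [r /andP[r0 r1] rP] := word_comp_contract.
have d0 : `|word_comp f e N (y N) - word_comp f e N (z N)| @[N --> \oo] -->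
    (0 : R).
  apply: (@squeeze_cvgr _ \oo _ R (cst 0) (fun N : nat => r ^+ N * (M + M))).
  - apply: nearW => N; rewrite normr_ge0/=; apply: le_trans (rP _ _ _ _) _.
    rewrite ler_wpM2l ?exprn_ge0//; apply: le_trans (ler_normB _ _) _.
    exact: lerD.
  - exact: cvg_cst.
  - rewrite -(mul0r (M + M)); apply: cvgM; last exact: cvg_cst.
    by apply: cvg_expr; rewrite ger0_norm.
move/norm_cvg0 in d0; rewrite -[x]add0r.
rewrite (_ : (fun N => _) = (fun N =>
  (word_comp f e N (y N) - word_comp f e N (z N)) + word_comp f e N (z N)));
  last by apply/funext => N; rewrite subrK.
exact: cvgD.
Qed.

Lemma attractor_bounded : exists2 M, 0 <= M & forall v, L v -> `|v| <= M.
Proof.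
have [[v Lv] /compact_bounded[M [_ LM]] _] := attrL.
have {}LM u : L u -> `|u| <= M + 1 by apply: LM; rewrite ltrDl.
by exists (M + 1) => //; exact: le_trans (LM _ Lv).
Qed.

(** Started from a point of [L], the approximations of [x] stay in the nested cylinders from stage
    [N] on, and a cylinder is compact, hence closed. *)
Lemma coding_in_cylinder x e N :
  is_coding f x e -> (word_comp f e N @` L) x.
Proof.
move=> xe; have [[v Lv] cL LE] := attrL.
have vx : word_comp f e M v @[M --> \oo] --> x.
  have [B B0 LB] := attractor_bounded.
  apply: (@word_comp_cvg_swap _ _ _ (fun=> 0) B) => // M; last by rewrite normr0.
  exact: LB.
have sub M k : word_comp f e (M + k) @` L `<=` word_comp f e M @` L.
  elim: k => [|k IHk]; first by rewrite addn0.
  rewrite addnS => _ [y Ly <-]; apply: IHk; exists (f (e (M + k)%N) y) => //.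
  by rewrite LE; exists (e (M + k)%N) => //; exists y.
have clN : closed (word_comp f e N @` L).
  apply: compact_closed; first exact: norm_hausdorff.
  apply: continuous_compact => //; apply: continuous_subspaceT.
  elim: N => [|N IHN] y; first exact: cvg_id.
  by apply: continuous_comp; [exact: similarity_continuous|exact: IHN].
apply: (closed_cvg _ clN _ _ vx); exists N => // M /= NM.
by apply: (sub N (M - N)%N); rewrite subnKC//; exists v.
Qed.

(** Preimages are chosen step by step inside [L]: the word of length [N] sends the point [u N] of
    [L] exactly to [x], and then the base point is swapped for 0. *)
Lemma coding_exists x : L x -> exists e, is_coding f x e.
Proof.
move=> Lx; have [_ _ LE] := attrL.
have step (u : {v | L v}) : exists w : 'I_n * {v | L v}, sval u = f w.1 (sval w.2).
  case: u => u Lu /=; have := Lu; rewrite {1}LE => -[j _ [v Lv <-]].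
  by exists (j, exist _ v Lv).
have [g gP] := choice step.
pose u k := iter k (fun u => (g u).2) (exist _ x Lx).
pose e k := (g (u k)).1.
have xE N : word_comp f e N (sval (u N)) = x.
  by elim: N => //= N IHN; rewrite -(gP (u N)).
have [B B0 LB] := attractor_bounded.
exists e; apply: (@word_comp_cvg_swap _ _ _ (fun N => sval (u N)) B) => [N|N|].
- by rewrite normr0.
- by apply: LB; exact: svalP.
- by under eq_fun do rewrite xE; exact: cvg_cst.
Qed.

Lemma coding_first_difference x e e' :
  is_coding f x e -> is_coding f x e' -> e <> e' ->
  exists s i j, i != j /\ (word_map s @` (f i @` L `&` f j @` L)) x.
Proof.
move=> xe xe' ee'.
have eN : exists N, e N != e' N.
  apply: contra_notP ee' => /forallNP ee'; apply/funext => N.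
  by apply/eqP/negPn/negP; exact: ee'.
case: (ex_minnP eN) => N {}eN minN.
exists (mkseq e N), (e N), (e' N); split => //.
have ee'N : mkseq e N = mkseq e' N.
  apply/eq_in_map => k; rewrite mem_iota/= add0n => kN.
  by apply/eqP; apply: contraLR kN => /minN; rewrite -leqNgt.
(* Length [N.+1] includes the first differing symbol, at position [N]; the common prefix is
   injective and can be cancelled. *)
have [y Ly] := coding_in_cylinder N.+1 xe.
have [y' Ly'] := coding_in_cylinder N.+1 xe'.
rewrite /= !word_comp_map -ee'N => y'x yx.
exists (f (e N) y) => //; split; first by exists y.
by exists y' => //; apply: (@word_map_inj (mkseq e N)); rewrite y'x yx.
Qed.

End attractor.

(** * Uniqueness of codings almost everywhere *)

Theorem corollary2p4 (R : realType) (d n : nat)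
    (lam : 'I_n -> R) (p : 'I_n -> 'rV[R]_d) (L : set 'rV[R]_d)
    (lam01 : forall j, 0 < lam j < 1)
    (attrL : is_attractor (similarity lam p) L)
    (sum_lam : \sum_(j < n) lam j ^+ d = 1)
    (L_gt0 : (0 < lebesgue_measure_rV L)%E) :
  {ae lebesgue_measure_rV, forall x : 'rV[R]_d,
    L x -> exists! e : nat -> 'I_n, is_coding (similarity lam p) x e}.
Proof.
pose f := similarity lam p.
pose D : set 'rV[R]_d := \big[setU/set0]_(ij : 'I_n * 'I_n | ij.1 != ij.2)
  (f ij.1 @` L `&` f ij.2 @` L).
have D0 : lebesgue_outer D = 0%E.
  apply/eqP; rewrite eq_le lebesgue_outer_ge0 andbT.
  apply: le_trans (outer_measure_bigsetU_le _ _ _) _.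
  by rewrite big1// => -[i j] /= ij; exact: attractor_overlap_null.
(* Words are enumerated by natural numbers; a number that codes no word contributes the empty
   set. *)
pose F k := if unpickle k is Some s then word_map lam p s @` D else set0.
have negF : (@lebesgue_measure_rV R d).-negligible (\bigcup_k F k).
  apply: negligible_bigcup => k; apply: lebesgue_outer_negligible.
  rewrite /F; case: unpickle => [s|]; last exact: lebesgue_outer0.
  exact: word_map_null.
(* By contraposition: outside every [F k], a coding of a point of [L] exists and a second one would
   put the point in some [F k]. *)
apply: negligibleS negF => x /= xP; apply: contra_notP xP => Fx Lx.
have [e xe] := coding_exists lam01 attrL Lx.
exists e; split => // e' xe'; apply: contrapT => ee'.
have [s [i [j [ij [y [yi yj] yx]]]]] :=
  coding_first_difference lam01 attrL xe xe' ee'.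
apply: Fx; exists (pickle s) => //; rewrite /F pickleK; exists y => //.
by rewrite /D (bigD1 (i, j))//; left.
Qed.
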